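(* Let $N\ge 3$ be an integer, $\alpha\in(0,N)$, $p>0$ and $q\in(0,1)$. Assume that $$\Big(1-\frac{\alpha}{N}\Big)p+q<1\qquad\text{and}\qquad p+q<1+\frac{\alpha}{N-2}.$$ Then the problem $$-\Delta u+u=I_\alpha[u^p]\,u^q\ \text{ in }\ \mathbb{R}^N\setminus\{0\},\qquad \lim_{|x|\to+\infty}u(x)=0,$$ has no nonnegative nontrivial (classical) solution.
   Context: For a nonnegative function $u$ on $\mathbb{R}^N\setminus\{0\}$, $I_\alpha[u^p](x)=\int_{\mathbb{R}^N}\frac{u^p(y)}{|x-y|^{N-\alpha}}\,dy$. A nonnegative function $u$ is a classical solution of the problem if $u\in C^2(\mathbb{R}^N\setminus\{0\})$, $I_\alpha[u^p](x)$ is well defined (finite) for every $x\in\mathbb{R}^N\setminus\{0\}$, the equation holds pointwise in $\mathbb{R}^N\setminus\{0\}$, and $u(x)\to0$ as $|x|\to+\infty$. Nontrivial means not identically zero. *)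

(* Defs.v *)
From HB Require Import structures.
From mathcomp Require Import all_boot all_order all_algebra.
From mathcomp Require Import all_classical all_reals all_analysis.

Set Implicit Arguments.
Unset Strict Implicit.
Unset Printing Implicit Defensive.
Import Order.TTheory GRing.Theory Num.Theory.
Import numFieldNormedType.Exports.

Local Open Scope classical_set_scope.
Local Open Scope ring_scope.

(* R^n is 'rV[R]_n. Its Borel sigma-algebra is obtained as the one generated by
   the coordinates. *)
Section measurable_rV.
Context (R : realType) (n : nat).

Let coord (i : 'I_n) (x : 'rV[R]_n) : measurableTypeR R := x ord0 i.

Let rV_set0 : g_sigma_preimage coord set0.
Proof. exact: sigma_algebra0. Qed.

Let rV_setC A : g_sigma_preimage coord A -> g_sigma_preimage coord (~` A).
Proof. exact: sigma_algebraC. Qed.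

Let rV_bigcup (F : _^nat) : (forall i, g_sigma_preimage coord (F i)) ->
  g_sigma_preimage coord (\bigcup_i (F i)).
Proof. exact: sigma_algebra_bigcup. Qed.

HB.instance Definition _ := @isMeasurable.Build default_measure_display
  'rV[R]_n (g_sigma_preimage coord) rV_set0 rV_setC rV_bigcup.

Lemma measurable_coord (i : 'I_n) :
  measurable_fun [set: 'rV[R]_n] (fun x => x ord0 i : measurableTypeR R).
Proof.
move=> _ Y mY; rewrite setTI; apply: sub_sigma_algebra => /=.
rewrite -bigcup_seq/=; exists i => /=; first by rewrite mem_index_enum.
by exists Y => //; rewrite setTI.
Qed.

Lemma measurable_fun_rV d (T : measurableType d) (f : T -> 'rV[R]_n) :
  (forall i, measurable_fun setT (fun t => f t ord0 i : measurableTypeR R)) ->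
  measurable_fun setT f.
Proof.
move=> mf _ Y mY; rewrite setTI.
suff : (measurable : set (set 'rV[R]_n)) `<=` [set A | measurable (f @^-1` A)].
  exact.
apply: smallest_sub => [|A].
  split=> /=; first by rewrite preimage_set0.
    by move=> A mA; rewrite setTD preimage_setC; exact: measurableC.
  by move=> F mF; rewrite preimage_bigcup; exact: bigcup_measurable.
rewrite -bigcup_seq/= => -[i _ [B mB <-]].
by have := mf i measurableT B mB; rewrite !setTI.
Qed.

End measurable_rV.

Definition row_cons (R : realType) (n : nat)
    (z : measurableTypeR R * 'rV[R]_n) : 'rV[R]_n.+1 :=
  row_mx (z.1%:M : 'rV[R]_1) z.2.

Lemma row_cons0 (R : realType) (n : nat) (z : measurableTypeR R * 'rV[R]_n) :
  row_cons z ord0 ord0 = z.1.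
Proof.
have -> : (ord0 : 'I_n.+1) = lshift n (ord0 : 'I_1) by exact/val_inj.
by apply: etrans (row_mxEl _ _ _ _) _; rewrite mxE eqxx mulr1n.
Qed.

Lemma row_consS (R : realType) (n : nat) (z : measurableTypeR R * 'rV[R]_n)
  (i : 'I_n) : row_cons z ord0 (lift ord0 i) = z.2 ord0 i.
Proof.
have -> : lift ord0 i = rshift 1 i by exact/val_inj.
exact: row_mxEr.
Qed.

Lemma measurable_row_cons (R : realType) (n : nat) :
  measurable_fun setT (@row_cons R n).
Proof.
apply: measurable_fun_rV => i; case: (unliftP ord0 i) => [j|] ->.
  under eq_fun do rewrite row_consS.
  exact: (measurableT_comp (measurable_coord j) measurable_snd).
by under eq_fun do rewrite row_cons0; exact: measurable_fst.
Qed.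

Section lebesgue_rV_succ.
Local Open Scope ereal_scope.
Context (R : realType) (n : nat).
Variable m : {sigma_finite_measure set 'rV[R]_n -> \bar R}.

Definition lebesgue_succ : set 'rV[R]_n.+1 -> \bar R :=
  pushforward (@lebesgue_measure R \x m) (@row_cons R n).

Let succ0 : lebesgue_succ set0 = 0.
Proof. by rewrite /lebesgue_succ /pushforward preimage_set0 measure0. Qed.

Let succ_ge0 A : 0 <= lebesgue_succ A.
Proof. by rewrite /lebesgue_succ /pushforward. Qed.

Let succ_sigma_additive : semi_sigma_additive lebesgue_succ.
Proof.
move=> F mF tF mUF; rewrite /lebesgue_succ /pushforward preimage_bigcup.
apply: measure_semi_sigma_additive.
- by move=> i; rewrite -[X in measurable X]setTI; exact: measurable_row_cons.
- apply/trivIsetP => /= i j _ _ ij; rewrite -preimage_setI.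
  by move/trivIsetP : tF => ->//; rewrite preimage_set0.
- rewrite -preimage_bigcup -[X in measurable X]setTI.
  exact: measurable_row_cons.
Qed.

HB.instance Definition _ := isMeasure.Build _ _ _ lebesgue_succ
  succ0 succ_ge0 succ_sigma_additive.

Let succ_sigma_finite : sigma_finite setT lebesgue_succ.
Proof.
have /sigma_finiteP[F [TF ndF Foo]] := sigma_finiteT (@lebesgue_measure R).
have /sigma_finiteP[G [TG ndG Goo]] := sigma_finiteT m.
pose hd (x : 'rV[R]_n.+1) : measurableTypeR R := x ord0 ord0.
pose tl (x : 'rV[R]_n.+1) : 'rV[R]_n := \row_i x ord0 (lift ord0 i).
have mhd : measurable_fun setT hd by exact: measurable_coord.
have mtl : measurable_fun setT tl.
  apply: measurable_fun_rV => i; under eq_fun do rewrite mxE.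
  exact: measurable_coord.
exists (fun k => (hd @^-1` F k) `&` (tl @^-1` G k)).
  apply/esym; rewrite -subTset => x _.
  have [i _ Fi] : (\bigcup_i F i) (hd x) by rewrite -TF.
  have [j _ Gj] : (\bigcup_i G i) (tl x) by rewrite -TG.
  exists (maxn i j) => //; split=> /=.
    by move: Fi; exact/subsetPset/ndF/leq_maxl.
  by move: Gj; exact/subsetPset/ndG/leq_maxr.
move=> k; have [mF Foo_k] := Foo k; have [mG Goo_k] := Goo k.
split.
  apply: measurableI; rewrite -[X in measurable X]setTI.
    exact: mhd.
  exact: mtl.
rewrite /lebesgue_succ /pushforward.
rewrite [X in product_measure1 _ _ X](_ : _ = F k `*` G k).
  by rewrite product_measure1E// lte_mul_pinfty// ge0_fin_numE.
apply/seteqP; split=> -[a b] /=; rewrite /hd /tl row_cons0 /=;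
  (have -> : \row_i row_cons (a, b) ord0 (lift ord0 i) = b by
    apply/rowP => i; rewrite mxE row_consS); by [].
Qed.

HB.instance Definition _ := Measure_isSigmaFinite.Build _ _ _ lebesgue_succ
  succ_sigma_finite.

End lebesgue_rV_succ.

(* The Lebesgue measure of R^n, as the n-fold product of that of R; R^0 is a
   point of mass 1. *)
Fixpoint lebesgue_rV (R : realType) (n : nat) :
    {sigma_finite_measure set 'rV[R]_n -> \bar R} :=
  match n with
  | 0%N => @dirac _ 'rV[R]_0 0 R
  | n'.+1 => lebesgue_succ (lebesgue_rV R n')
  end.

Lemma lebesgue_rV_box (R : realType) (n : nat)
    (A : 'I_n -> set (measurableTypeR R)) : (forall i, measurable (A i)) ->
  lebesgue_rV R n [set x | forall i, A i (x ord0 i)] =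
  (\prod_(i < n) lebesgue_measure (A i))%E.
Proof.
elim: n A => [|n IHn] A mA.
  by rewrite big_ord0/= diracE mem_set// => -[].
rewrite big_ord_recl -IHn => [|i]; last exact: mA.
have mB : measurable [set x : 'rV[R]_n | forall i, A (lift ord0 i) (x ord0 i)].
  rewrite [X in measurable X](_ : _ = \bigcap_(i in [set: 'I_n])
    ((fun x : 'rV[R]_n => x ord0 i : measurableTypeR R) @^-1` A (lift ord0 i))).
    apply: fin_bigcap_measurable => [|i _]; first exact: finite_finset.
    by rewrite -[X in measurable X]setTI; exact: measurable_coord.
  by apply/seteqP; split=> x /= Ax i; [move=> _|]; exact: Ax.
rewrite -product_measure1E//= /lebesgue_succ /pushforward; congr (_ _).
apply/seteqP; split=> -[a b] /=.
  move=> Ax; split=> [|i]; first by have := Ax ord0; rewrite row_cons0.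
  by have := Ax (lift ord0 i); rewrite row_consS.
move=> [Aa Ab] i; case: (unliftP ord0 i) => [j|] ->; last by rewrite row_cons0.
by rewrite row_consS.
Qed.

Section calculus.
Context (R : realType) (n : nat).
Implicit Types (U : set 'rV[R]_n) (u : 'rV[R]_n -> R) (x y : 'rV[R]_n).

(* The library norm `|x| of 'rV[R]_n is the sup norm. *)
Definition enorm x : R := Num.sqrt (\sum_(i < n) x ord0 i ^+ 2).

Definition partial (i : 'I_n) u : 'rV[R]_n -> R := 'D_(delta_mx ord0 i) u.

Fixpoint Ck (k : nat) U u : Prop :=
  (forall x, U x -> {for x, continuous u}) /\
  match k with
  | 0%N => True
  | k'.+1 => forall i : 'I_n,
      (forall x, U x -> derivable u x (delta_mx ord0 i)) /\ Ck k' U (partial i u)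
  end.

Definition laplacian u x : R := \sum_(i < n) partial i (partial i u) x.

Definition punctured : set 'rV[R]_n := [set x | x != 0].

(* u is only meaningful on the punctured space; the omitted point is Lebesgue
   null. The value at y = x of the integrand (0, as 0^-1 = 0) is irrelevant for
   the same reason. *)
Definition riesz_potential (alpha p : R) u x : \bar R :=
  (\int[lebesgue_rV R n]_(y in punctured)
     (u y `^ p / enorm (x - y) `^ (n%:R - alpha))%:E)%E.

Definition at_infinity : set_system 'rV[R]_n :=
  filter_from [set: R] (fun M => [set x | M < enorm x]).

Record nonneg_classical_solution (alpha p q : R) u : Prop := {
  sol_ge0 : forall x, punctured x -> 0 <= u x ;
  sol_C2 : Ck 2 punctured u ;
  sol_fin : forall x, punctured x -> riesz_potential alpha p u x \is a fin_num ;
  sol_eq : forall x, punctured x ->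
    - laplacian u x + u x = fine (riesz_potential alpha p u x) * u x `^ q ;
  sol_lim : u x @[x --> at_infinity] --> (0 : R)
}.

Definition nontrivial u : Prop := exists2 x, punctured x & u x != 0.

End calculus.

(* Main.v *)
(* A nontrivial solution is positive, by the strong maximum principle: it is a
   supersolution of [- Delta u + u = 0]. Comparing [u] on unit balls with
   multiples of [(1 - |x - y|^2)^2] gives [u y ^ (1 - q) >= c inf I[u^p]], the
   infimum being over the unit ball around [y]. Hence a bound
   [I[u^p] >= c |x|^b] near infinity yields [u >= c |x|^(b / (1 - q))], which in
   turn yields [I[u^p] >= c |x|^(alpha + p b / (1 - q))]. Starting from
   [I[u^p] >= c |x|^(alpha - N)], and as long as they are negative, the exponents
   increase by at least a fixed amount at each step, because
   [(1 - alpha / N) p + q < 1]; hence they eventually become nonnegative, and [u]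
   does not tend to 0. *)
Require Import Defs.
From mathcomp Require Import all_boot all_order all_algebra.
From mathcomp Require Import all_classical all_reals all_analysis.
From mathcomp Require Import ring lra.
Import Order.TTheory GRing.Theory Num.Theory.
Import numFieldNormedType.Exports.

Local Open Scope classical_set_scope.
Local Open Scope ring_scope.

(** * One-variable calculus at a minimum *)

(** Fermat gives [f1 0 = 0]. If [l < 0], then [f1] is negative just to the right of 0, and the mean
    value theorem puts [f] below [f 0] there. *)
Lemma second_derive_ge0_at_min {R : realType} {f f1 : R -> R} {l d : R} :
  0 < d -> (forall s, `|s| < d -> is_derive (s : R) (1 : R) f (f1 s)) ->
  is_derive (0 : R) (1 : R) f1 l -> (forall s, `|s| < d -> f 0 <= f s) -> 0 <= l.
Proof.
move=> d0 df df1 fmin.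
have itvd (s : R) : (s \in `]- d, d[%R) = (`|s| < d) by rewrite in_itv/= ltr_norml.
have f10 : f1 0 = 0.
  have [_ <-] : is_derive (0 : R) (1 : R) f (f1 0) by apply: df; rewrite normr0.
  suff : is_derive (0 : R) (1 : R) f 0 by case.
  apply: (@derive1_at_min _ f (- d) d).
  - lra.
  - by move=> t; rewrite itvd => td; have [] := df t td.
  - by rewrite itvd normr0.
  - by move=> t; rewrite itvd; exact: fmin.
rewrite leNgt; apply/negP => l0.
have [df10 f1l] := df1.
have : \forall h \near (0 : R)^', h^-1 * f1 h < 0.
  have c : (h^-1 *: ((f1 \o shift 0) (h *: (1 : R)) - f1 0)) @[h --> (0 : R)^'] --> l.
    by rewrite -f1l; exact: df10.
  apply: filterS (cvgr_lt l c 0 l0) => h /=.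
  by rewrite f10 subr0 addr0 /GRing.scale/= mulr1.
move=> /nbhs_ballP[e /= e0 He].
pose s := Num.min (e / 2) (d / 2).
have s0 : 0 < s by rewrite lt_min; apply/andP; split; lra.
have [se sd] : s <= e / 2 /\ s <= d / 2 by rewrite !ge_min !lexx orbT.
have inb t : t \in `[0, s]%R -> `|t| < d.
  by rewrite in_itv/= => /andP[t0 ts]; rewrite ger0_norm//; lra.
have [||c cin E] := @MVT _ f f1 0 s s0.
- by move=> t /subset_itv_oo_cc /inb; exact: df.
- apply: derivable_within_continuous => t /inb td; by have [] := df t td.
have : f s - f 0 < 0.
  rewrite E subr0 pmulr_llt0//; move: cin; rewrite in_itv/= => /andP[c0 cs].
  have := He c; rewrite /ball/= sub0r normrN gtr0_norm// => /(_ _ _).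
  by rewrite pmulr_rlt0 ?invr_gt0//; apply; [lra|rewrite gt_eqF].
by rewrite subr_lt0 ltNge fmin// inb// in_itv/= lexx ltW.
Qed.

(** * Euclidean inner product, norm and closed balls *)

Section euclidean.
Context {R : realType} {n : nat}.
Implicit Types (x y z : 'rV[R]_n).

Definition dot x y : R := \sum_(i < n) x ord0 i * y ord0 i.

Lemma dotC x y : dot x y = dot y x.
Proof. by apply: eq_bigr => i _; rewrite mulrC. Qed.

Lemma dotDl x y z : dot (x + y) z = dot x z + dot y z.
Proof. by rewrite -big_split; apply: eq_bigr => i _; rewrite mxE mulrDl. Qed.

Lemma dotZl a x y : dot (a *: x) y = a * dot x y.
Proof. by rewrite mulr_sumr; apply: eq_bigr => i _; rewrite mxE mulrA. Qed.

Lemma dotNl x y : dot (- x) y = - dot x y.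
Proof. by rewrite -scaleN1r dotZl mulN1r. Qed.

Lemma dotDr x y z : dot x (y + z) = dot x y + dot x z.
Proof. by rewrite dotC dotDl !(dotC x). Qed.

Lemma dotZr a x y : dot x (a *: y) = a * dot x y.
Proof. by rewrite dotC dotZl dotC. Qed.

Lemma dotNr x y : dot x (- y) = - dot x y.
Proof. by rewrite dotC dotNl dotC. Qed.

Lemma dot0l x : dot 0 x = 0.
Proof. by rewrite -(scale0r 0) dotZl mul0r. Qed.

Lemma dot0r x : dot x 0 = 0.
Proof. by rewrite dotC dot0l. Qed.

Lemma dot_delta i x : dot (delta_mx ord0 i) x = x ord0 i.
Proof.
rewrite /dot (bigD1 i)//= big1 => [|j ji]; rewrite mxE eqxx/=.
  by rewrite eqxx mul1r addr0.
by rewrite (negbTE ji) mul0r.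
Qed.

Lemma dot_ge0 x : 0 <= dot x x.
Proof. by apply: sumr_ge0 => i _; rewrite -expr2 sqr_ge0. Qed.

Lemma dot_gt0 x : (0 < dot x x) = (x != 0).
Proof.
apply/idP/idP => [|x0].
  by apply: contraTneq => ->; rewrite dot0l ltxx.
rewrite lt0r dot_ge0 andbT; apply: contra_neq x0 => /eqP.
rewrite psumr_eq0 => [/allP x0|i _]; last by rewrite -expr2 sqr_ge0.
apply/rowP => i; rewrite mxE; apply/eqP.
by have := x0 i (mem_index_enum i); rewrite mulf_eq0 orbb.
Qed.

Lemma dot_add_sqr x y : dot (x + y) (x + y) = dot x x + 2 * dot x y + dot y y.
Proof. rewrite dotDl !dotDr (dotC y x); ring. Qed.

Lemma dot_sub_sqr x y : dot (x - y) (x - y) = dot x x - 2 * dot x y + dot y y.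
Proof. rewrite dot_add_sqr !dotNr dotNl; ring. Qed.

Lemma continuous_dot y : continuous (fun x => dot (x - y) (x - y)).
Proof.
rewrite /dot; apply: continuous_big => [|i _ x]; first exact: add_continuous.
have c : continuous_at x (fun x : 'rV[R]_n => (x - y) ord0 i).
  under eq_fun do rewrite !mxE.
  exact: (continuousB (@coord_continuous R 1 n ord0 i x)
    (@cst_continuous _ _ (y ord0 i) x)).
exact: (continuousM c c).
Qed.

Lemma continuous_dot0 : continuous (fun x => dot x x).
Proof. by have := continuous_dot 0; under eq_fun do rewrite subr0. Qed.

Lemma nbhs_punctured {z} : z != 0 -> \forall x \near z, x != 0.
Proof.
rewrite -dot_gt0 => z0.
by apply: filterS (cvgr_gt _ (@continuous_dot0 z) _ z0) => x; rewrite -dot_gt0.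
Qed.

Lemma enormE x : enorm x = Num.sqrt (dot x x).
Proof. by rewrite /enorm; under eq_bigr do rewrite expr2. Qed.

Lemma enorm_ge0 x : 0 <= enorm x.
Proof. exact: sqrtr_ge0. Qed.

Lemma enorm_sqr x : enorm x ^+ 2 = dot x x.
Proof. by rewrite enormE sqr_sqrtr// dot_ge0. Qed.

Lemma enorm_gt0 x : (0 < enorm x) = (x != 0).
Proof. by rewrite enormE sqrtr_gt0 dot_gt0. Qed.

(** Cauchy-Schwarz: the vector [|y| x - |x| y] has squared length [2 |x| |y| (|x| |y| - x.y)]. *)
Lemma dot_le_enorm x y : dot x y <= enorm x * enorm y.
Proof.
have [->|x0] := eqVneq x 0.
  by rewrite dot0l mulr_ge0// enorm_ge0.
have := dot_ge0 (enorm y *: x - enorm x *: y).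
rewrite dot_sub_sqr !dotZl !dotZr -!enorm_sqr => h.
have [->|y0] := eqVneq y 0.
  by rewrite dot0r mulr_ge0// enorm_ge0.
have xy0 : 0 < enorm x * enorm y by rewrite mulr_gt0// enorm_gt0.
rewrite -(ler_pM2l xy0); nra.
Qed.

Lemma enormD x y : enorm (x + y) <= enorm x + enorm y.
Proof.
rewrite -(@ler_pXn2r _ 2)// ?nnegrE ?addr_ge0 ?enorm_ge0//.
rewrite sqrrD !enorm_sqr dot_add_sqr; have := dot_le_enorm x y; lra.
Qed.

Lemma enormN x : enorm (- x) = enorm x.
Proof. by rewrite !enormE dotNl dotNr opprK. Qed.

Lemma enormBC x y : enorm (x - y) = enorm (y - x).
Proof. by rewrite -enormN opprB. Qed.

Lemma enormZ a x : 0 <= a -> enorm (a *: x) = a * enorm x.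
Proof.
move=> a0; rewrite !enormE dotZl dotZr mulrA sqrtrM ?mulr_ge0// -expr2.
by rewrite sqrtr_sqr ger0_norm.
Qed.

Lemma enormB_ge x y : enorm x - enorm y <= enorm (x - y).
Proof. by rewrite lerBlDr -{1}(subrK y x) enormD. Qed.

Lemma compact_closed_ball y r : compact [set x | dot (x - y) (x - y) <= r].
Proof.
apply: bounded_closed_compact; last first.
  exact: (closed_comp (fun x _ => @continuous_dot y x) (@closed_le R r)).
(* The square of [1 + |r|] exceeds [r], so [1 + |r|] bounds every coordinate of [x - y] without a
   square root. *)
exists (`|y| + (1 + `|r|)); split; first by rewrite num_real.
move=> M yM x /= xr; apply: (le_trans _ (ltW yM)).
rewrite -[x](subrK y) addrC (le_trans (ler_normD _ _))// lerD2l.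
rewrite [leLHS]/Num.norm/= mx_normrE; apply: bigmax_le => [|[j i] _ /=].
  by rewrite addr_ge0.
rewrite (ord1 j) -ler_sqr ?nnegrE ?addr_ge0// real_normK ?num_real//.
apply: (@le_trans _ _ r).
  apply: le_trans xr; rewrite /dot (bigD1 i)//= -expr2 lerDl.
  by apply: sumr_ge0 => k _; rewrite -expr2 sqr_ge0.
rewrite (le_trans (ler_norm _))//; have := normr_ge0 r; nra.
Qed.

End euclidean.

(** * Functions touched from below by a bubble *)

Section touching.
Context {R : realType}.

Lemma is_derive_line {V : normedModType R} {f : V -> R} {x v : V} {s : R} :
  derivable f (s *: v + x) v ->
  is_derive s (1 : R) (fun r => f (r *: v + x)) ('D_v f (s *: v + x)).
Proof.
have E : (fun h : R => h^-1 *: (((fun r => f (r *: v + x)) \o shift s) (h *: (1 : R))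
    - f (s *: v + x))) =
    (fun h : R => h^-1 *: ((f \o shift (s *: v + x)) (h *: v) - f (s *: v + x))).
  by apply/funext => h /=; rewrite [h *: 1]mulr1 scalerDl addrA.
by move=> df; split; rewrite /derivable/derive E.
Qed.

Lemma is_derive_scale_horner (t : R) (P : {poly R}) (s : R) :
  is_derive s (1 : R) (fun r => t * P.[r]) (t * P^`().[s]).
Proof. exact: (@is_deriveZ R R R (horner P) t s 1 P^`().[s]). Qed.

Context {n : nat}.
Implicit Types (x y z : 'rV[R]_n).

(** [r] is the squared radius of the ball on whose boundary the function vanishes, for [k > 0]. A
    large [k] makes it a strict subsolution away from the centre. *)
Definition bubble (r : R) y (k : nat) x : R := (r - dot (x - y) (x - y)) ^+ k.

Lemma continuous_bubble r y k : continuous (bubble r y k).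
Proof.
move=> x; apply: (@continuous_comp _ _ _
  (fun x => r - dot (x - y) (x - y)) (fun s : R => s ^+ k)).
  exact: (continuousB (@cst_continuous _ _ r x) (@continuous_dot _ _ y x)).
exact: exprn_continuous.
Qed.

(** The bubble on the line through [z] in direction [i], as a polynomial, so that its second
    derivative is a formal computation. *)
Let line (r : R) y z (i : 'I_n) (k : nat) : {poly R} :=
  ((r - dot (z - y) (z - y))%:P - (2 * (z - y) ord0 i) *: 'X - 'X ^+ 2) ^+ k.

Let line_bubble r y z i k s :
  (line r y z i k).[s] = bubble r y k (s *: delta_mx ord0 i + z).
Proof.
rewrite /line/bubble hornerE; congr (_ ^+ _); rewrite !hornerE.
rewrite -[s *: _ + z - y]addrA [dot (_ *: _ + _) _]dot_add_sqr.
rewrite !dotZl !dotZr !dot_delta [delta_mx _ _ _ _]mxE !eqxx/=; ring.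
Qed.

Let exp_deriv2 (p : {poly R}) k (x : R) : (p ^+ k.+2)^`()^`().[x] =
  k.+2%:R * k.+1%:R * p.[x] ^+ k * p^`().[x] ^+ 2
  + k.+2%:R * p.[x] ^+ k.+1 * p^`()^`().[x].
Proof.
rewrite deriv_exp derivMn derivM deriv_exp !(hornerMn, hornerD, hornerM, horner_exp) /=.
rewrite -!(mulr_natl (_ * _)); ring.
Qed.

Let line_deriv2 r y z i k : (line r y z i k.+2)^`()^`().[0] =
  k.+2%:R * k.+1%:R * bubble r y k z * (4 * (z - y) ord0 i ^+ 2)
  - 2 * k.+2%:R * bubble r y k.+1 z.
Proof.
rewrite exp_deriv2 !(derivB, derivC, derivZ, derivX, derivXn, derivMn) !hornerE/= /bubble.
rewrite expr0n/= !subr0; ring.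
Qed.

(** The lower bound is [t] times the Laplacian of the bubble of exponent [k.+2] at [z]. The
    difference has a local minimum there, so its second derivative in each coordinate direction is
    nonnegative. *)
Lemma laplacian_ge_touching {u : 'rV[R]_n -> R} {r y z t} {k : nat} :
  z != 0 -> Ck 2 (@punctured R n) u ->
  (\forall x \near z, u z - t * bubble r y k.+2 z <= u x - t * bubble r y k.+2 x) ->
  t * (k.+2%:R * k.+1%:R * bubble r y k z * (4 * dot (z - y) (z - y))
       - 2 * n%:R * k.+2%:R * bubble r y k.+1 z) <= laplacian u z.
Proof.
move=> z0 [_ C2] umin.
have -> : 2 * n%:R * k.+2%:R * bubble r y k.+1 z =
    \sum_(i < n) 2 * k.+2%:R * bubble r y k.+1 z.
  by rewrite sumr_const card_ord -mulr_natl; ring.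
rewrite /dot !mulr_sumr -sumrB mulr_sumr; apply: ler_sum => i _.
pose e : 'rV[R]_n := delta_mx ord0 i; pose P := line r y z i k.+2.
rewrite -subr_ge0.
have [D1 [_ /(_ i)[D2 _]]] := C2 i.
have near_line : \forall s \near (0 : R), s *: e + z != 0 /\
    u z - t * bubble r y k.+2 z <= u (s *: e + z) - t * bubble r y k.+2 (s *: e + z).
  have cl : (fun s : R => s *: e + z) s @[s --> (0 : R)] --> z.
    rewrite -[X in _ --> X]add0r -(scale0r e).
    by apply: cvgD; [apply: cvgZr_tmp|exact: cvg_cst].
  exact: (cl _ (filterI (nbhs_punctured z0) umin)).
have [d /= d0 dP] := (nbhs_ballP _ _).1 near_line.
have {dP near_line}near0 s : `|s| < d -> s *: e + z != 0 /\
    u z - t * bubble r y k.+2 z <= u (s *: e + z) - t * bubble r y k.+2 (s *: e + z).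
  by move=> sd; apply: dP; rewrite /ball/= sub0r normrN.
apply: (@second_derive_ge0_at_min _
  (fun s => u (s *: e + z) - t * P.[s])
  (fun s => partial i u (s *: e + z) - t * P^`().[s]) _ d) => //.
- move=> s /near0[sz _].
  exact: (is_deriveB (is_derive_line (D1 _ sz)) (is_derive_scale_horner t P s)).
- have D2z : derivable (partial i u) (0 *: e + z) e.
    by apply: D2; rewrite scale0r add0r.
  apply: is_derive_eq (is_deriveB (is_derive_line D2z)
    (is_derive_scale_horner t P^`() 0)) _.
  by rewrite scale0r add0r /P line_deriv2 -expr2 /partial.
- by move=> s /near0[_]; rewrite /P !line_bubble scale0r add0r.
Qed.

End touching.

(** * Strong maximum principle and a local lower bound *)

Section maximum_principle.
Context {R : realType} {n : nat} {u : 'rV[R]_n -> R}.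
Implicit Types (x y z : 'rV[R]_n).

(** Neighbourhoods come from the sup norm, whose balls contain the Euclidean balls of the same
    radius; [r] is a squared radius. *)
Lemma near_dot_lt {P : 'rV[R]_n -> Prop} {y} : (\forall x \near y, P x) ->
  exists2 r : R, 0 < r & forall x, dot (x - y) (x - y) < r -> P x.
Proof.
move=> /nbhs_ballP[e /= e0 eP]; exists (e ^+ 2); first by rewrite exprn_gt0.
move=> x xe; apply: eP; split=> // i j; rewrite (ord1 i) /ball/= -normrN opprB.
rewrite -ltr_sqr ?nnegrE ?(ltW e0)// real_normK ?num_real//.
apply: le_lt_trans xe; rewrite /dot (bigD1 j)//= !mxE -expr2 lerDl.
by apply: sumr_ge0 => k _; rewrite -expr2 sqr_ge0.
Qed.

Hypothesis C2u : Ck 2 (@punctured R n) u.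

(** As [r < |y|^2], the closed ball avoids the origin, so [u] is continuous on this compact set. A
    minimum point inside the open ball is a local minimum in the whole space, as the touching lemma
    requires. *)
Let min_bubble {y r t} (k : nat) : 0 <= r -> r < dot y y ->
  exists c, [/\ c != 0, dot (c - y) (c - y) <= r,
    forall x, dot (x - y) (x - y) <= r ->
      u c - t * bubble r y k c <= u x - t * bubble r y k x &
    dot (c - y) (c - y) < r -> \forall x \near c,
      u c - t * bubble r y k c <= u x - t * bubble r y k x].
Proof.
move=> r0 ry; set K := [set x | dot (x - y) (x - y) <= r].
have K0 x : K x -> x != 0.
  by rewrite /K/=; apply: contraTneq => ->; rewrite sub0r dotNl dotNr opprK -ltNge.
have [||c] := @EVT_min_rV R n (fun x => u x - t * bubble r y k x) K _
    (compact_closed_ball y r).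
- by exists y; rewrite /K/= subrr dot0l.
- apply: continuous_in_subspaceT => x; rewrite inE => /K0 x0.
  exact: (continuousB (C2u.1 x x0)
    (continuousM (@cst_continuous _ _ t x) (@continuous_bubble _ _ r y k x))).
rewrite inE => Kc cmin.
have cmin' x : K x -> u c - t * bubble r y k c <= u x - t * bubble r y k x.
  by move=> Kx; apply: cmin; rewrite inE.
exists c; split => //; first exact: K0.
move=> cr; apply: filterS (cvgr_lt _ (@continuous_dot _ _ y c) _ cr) => x /ltW.
exact: cmin'.
Qed.

(* Hopf's argument: [u] is compared on the ball of centre [y] with a small
   multiple of a bubble that is a strict subsolution away from a neighbourhood
   of [y]. *)
Lemma pos_propagates {y z} :
  (forall x, x != 0 -> 0 <= u x) -> (forall x, x != 0 -> laplacian u x <= u x) ->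
  y != 0 -> 0 < u y -> dot (z - y) (z - y) < dot y y -> 0 < u z.
Proof.
move=> u0 lapu y0 uy zy.
have [r zr ry] : exists2 r, dot (z - y) (z - y) < r & r < dot y y.
  by exists ((dot (z - y) (z - y) + dot y y) / 2); lra.
have r0 : 0 < r := le_lt_trans (dot_ge0 _) zr.
have [rho rho0 urho] : exists2 rho : R, 0 < rho &
    forall x, dot (x - y) (x - y) < rho -> u y / 2 < u x.
  apply: near_dot_lt; apply: cvgr_gt (C2u.1 y y0) _ _; lra.
(* With this [k], the Laplacian of the bubble of exponent [k.+2] exceeds the bubble at the points of
   the open ball where [|x - y|^2 >= rho]. *)
pose k := Num.trunc ((2 * n%:R * r + r ^+ 2) / (4 * rho)).
have hk : 2 * n%:R * r + r ^+ 2 < k.+1%:R * (4 * rho).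
  by rewrite -ltr_pdivrMr ?mulr_gt0// truncnS_gt.
(* [t] times the bubble is at most [u y / 2] on the ball, so the difference cannot be negative
   within squared distance [rho] of [y]. *)
pose t := u y / 2 / r ^+ k.+2.
have t0 : 0 < t by rewrite divr_gt0 ?exprn_gt0// divr_gt0.
have [c [c0 cr cmin cnear]] := @min_bubble y r t k.+2 (ltW r0) ry.
suff gc : 0 <= u c - t * bubble r y k.+2 c.
  have := le_trans gc (cmin z (ltW zr)); rewrite subr_ge0; apply: lt_le_trans.
  by rewrite mulr_gt0// exprn_gt0// subr_gt0.
rewrite leNgt; apply/negP => gc.
(* Since [u c >= 0], a negative minimum forces the bubble to be positive at [c]; hence [c] is not on
   the sphere. *)
have b0 : 0 < bubble r y k.+2 c.
  by have := u0 c c0; rewrite -(pmulr_rgt0 _ t0); lra.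
pose D := r - dot (c - y) (c - y).
have D0 : 0 < D.
  rewrite lt0r subr_ge0 cr andbT; apply: contraTneq b0 => /= D0.
  by rewrite /bubble -/D D0 expr0n/= ltxx.
have cD : rho <= dot (c - y) (c - y).
  rewrite leNgt; apply/negP => /urho uc.
  suff : t * bubble r y k.+2 c <= u y / 2 by lra.
  rewrite /t -mulrA ler_piMr//; first lra.
  rewrite mulrC ler_pdivrMr ?exprn_gt0// mul1r /bubble.
  by rewrite lerXn2r ?nnegrE ?(ltW r0)//; [exact: ltW|rewrite gerBl dot_ge0].
have Dr : D <= r by rewrite gerBl dot_ge0.
(* The contradiction at [c]: the Laplacian of [u] is at least [t] times that of the bubble, which
   exceeds [t] times the bubble and thus [u c]. *)
have := laplacian_ge_touching c0 C2u (cnear _).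
rewrite -subr_gt0 -/D => /(_ D0) lapc.
have := lapu c c0; apply/negP; rewrite -ltNge; apply: lt_le_trans lapc.
have uct : u c < t * bubble r y k.+2 c by lra.
apply: (lt_trans uct); rewrite ltr_pM2l// /bubble -/D.
rewrite [D ^+ k.+2]exprSr [D ^+ k.+1]exprSr.
have -> : k.+2%:R * k.+1%:R * D ^+ k * (4 * dot (c - y) (c - y)) -
    2 * n%:R * k.+2%:R * (D ^+ k * D) =
  D ^+ k * (k.+2%:R * (k.+1%:R * (4 * dot (c - y) (c - y)) - 2 * n%:R * D)).
  ring.
rewrite -mulrA ltr_pM2l ?exprn_gt0//.
have n0 : (0 : R) <= n%:R by [].
have k1 : (1 : R) <= k.+2%:R by rewrite ler1n.
have kc : k.+1%:R * (4 * rho) <= k.+1%:R * (4 * dot (c - y) (c - y)).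
  by rewrite ler_pM2l// ler_pM2l.
have nD : n%:R * D <= n%:R * r by rewrite ler_wpM2l.
have DD : D * D <= r ^+ 2 by rewrite expr2 ler_pM// ltW.
set X := k.+1%:R * _ - _; have X0 : D * D < X by rewrite /X; lra.
rewrite (lt_le_trans X0)// ler_peMl//.
by rewrite ltW// (lt_trans _ X0)// mulr_gt0.
Qed.

(* [8 / (9 + 4 n)] bounds [1 - |x - y|^2] from below wherever
   [- Delta phi + phi > 0] for [phi = (1 - |x - y|^2)^2]. *)
Definition ball_const : R := (8 / (9 + 4 * n%:R)) ^+ 2 / (9 + 4 * n%:R).

Lemma ball_const_gt0 : 0 < ball_const.
Proof. by rewrite divr_gt0 ?exprn_gt0 ?divr_gt0 ?ltr_pwDl. Qed.

(** Let [t] times the bubble touch [u] from below at [z], where the bubble is [w ^ 2]. The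
    inequality for [u] at [z] then gives [a t^q w^2 <= t ((9 + 4 n) w - 8)]. Positivity of the left
    side bounds [w] below, division by [t^q] bounds [t^(1 - q)] below, and [t <= u y] because the
    bubble is 1 at [y]. *)
Lemma powR_lower_bound {a q y} : 0 < q -> q < 1 -> 0 < a -> 1 < dot y y ->
  (forall x, x != 0 -> 0 < u x) ->
  (forall x, dot (x - y) (x - y) <= 1 -> a * u x `^ q <= - laplacian u x + u x) ->
  ball_const * a <= u y `^ (1 - q).
Proof.
move=> q0 q1 a0 y1 upos ueq.
set K := [set x | dot (x - y) (x - y) <= 1].
have K0 x : K x -> x != 0.
  rewrite /K/=; apply: contraTneq => ->.
  by rewrite sub0r dotNl dotNr opprK -ltNge.
have Ky : K y by rewrite /K/= subrr dot0l.
(* The quotient is taken this way round because the bubble vanishes on the sphere whereas [u] is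
   positive on the whole ball. *)
have [||z] := @EVT_max_rV R n (fun x => bubble 1 y 2 x / u x) K _
    (compact_closed_ball y 1).
- by exists y.
- apply: continuous_in_subspaceT => x; rewrite inE => /K0 x0.
  have ux : u x != 0 by rewrite gt_eqF// upos.
  exact: (continuousM (@continuous_bubble _ _ 1 y 2 x) (continuousV ux (C2u.1 x x0))).
rewrite inE => Kz zmax; have z0 := K0 _ Kz; have uz := upos _ z0.
have by1 : bubble 1 y 2 y = 1.
  by rewrite /bubble subrr dot0l subr0 expr1n.
(* [t] is the largest number such that [t] times the bubble stays below [u]. *)
pose t := u z / bubble 1 y 2 z; pose w := 1 - dot (z - y) (z - y).
have uy : 0 < u y := upos _ (K0 _ Ky).
have bz : 0 < bubble 1 y 2 z.
  have := zmax y; rewrite inE => /(_ Ky); rewrite by1 => /(lt_le_trans _) h.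
  have := h 0; rewrite divr_gt0// => /(_ isT).
  by rewrite pmulr_lgt0 ?invr_gt0.
have t0 : 0 < t by rewrite divr_gt0.
have below x : K x -> t * bubble 1 y 2 x <= u x.
  move=> Kx; have := zmax x; rewrite inE => /(_ Kx).
  rewrite ler_pdivrMr ?upos ?K0// => h.
  rewrite /t mulrAC ler_pdivrMr//.
  move: h; rewrite mulrAC ler_pdivlMr//; nra.
have uzE : u z = t * bubble 1 y 2 z by rewrite divfK// gt_eqF.
have w0 : 0 < w.
  have w0' : 0 <= w by rewrite subr_ge0.
  rewrite lt0r w0' andbT; apply: contraTneq bz => /= D0.
  by rewrite /bubble -/w D0 expr0n/= ltxx.
have w1 : w <= 1 by rewrite gerBl dot_ge0.
have lapz := @laplacian_ge_touching R n u 1 y z t 0 z0 C2u.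
have {}lapz : t * (8 * (1 - w) - 4 * n%:R * w) <= laplacian u z.
  apply: le_trans (lapz _); last first.
    have zy1 : dot (z - y) (z - y) < 1 by rewrite -subr_gt0.
    apply: filterS (cvgr_lt _ (@continuous_dot _ _ y z) _ zy1) => x /ltW Kx.
    by rewrite uzE subrr subr_ge0 below.
  by rewrite ler_pM2l// /bubble expr0 expr1 -/w /w; lra.
have := ueq _ Kz; rewrite uzE powRM ?(ltW t0) ?(ltW bz)// => h.
have n0 : (0 : R) <= n%:R by [].
have b1 : bubble 1 y 2 z = w ^+ 2 by [].
have w2 : w ^+ 2 <= bubble 1 y 2 z `^ q.
  rewrite b1; apply: ger1_powR; last exact: ltW.
  by rewrite exprn_gt0// expr_le1// ltW.
have tq : 0 < t `^ q by rewrite powR_gt0.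
have h2 : a * (t `^ q * w ^+ 2) <= t * ((9 + 4 * n%:R) * w - 8).
  have : a * (t `^ q * w ^+ 2) <= a * (t `^ q * bubble 1 y 2 z `^ q).
    by rewrite ler_pM2l// ler_pM2l.
  have : t * w ^+ 2 <= t * w by rewrite ler_pM2l// expr2 ler_piMr// ltW.
  rewrite b1 in h *; lra.
have c0 : 0 < 9 + 4 * n%:R :> R by rewrite ltr_pwDl.
have w8 : 8 / (9 + 4 * n%:R) <= w.
  have : 0 < t * ((9 + 4 * n%:R) * w - 8).
    by apply: lt_le_trans h2; rewrite !mulr_gt0// exprn_gt0.
  by rewrite pmulr_rgt0// ler_pdivrMr//; lra.
have t1 : t = t `^ q * t `^ (1 - q).
  have E : q + (1 - q) = 1 by lra.
  rewrite -powRD E ?oner_eq0// powRr1//; exact: ltW.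
have ty : t `^ (1 - q) <= u y `^ (1 - q).
  apply: ge0_ler_powR; rewrite ?nnegrE ?(ltW t0) ?(ltW uy)//; first lra.
  by have := below y Ky; rewrite by1 mulr1.
apply: le_trans ty; rewrite /ball_const mulrAC ler_pdivrMr//.
rewrite -(ler_pM2l tq).
have -> : t `^ q * (t `^ (1 - q) * (9 + 4 * n%:R)) = t * (9 + 4 * n%:R).
  by rewrite mulrA -t1.
apply: (@le_trans _ _ (a * (t `^ q * w ^+ 2))).
  have : (8 / (9 + 4 * n%:R)) ^+ 2 <= w ^+ 2.
    by rewrite lerXn2r// nnegrE ?divr_ge0// ltW.
  move=> /(ler_wpM2l (ltW a0)) /(ler_wpM2l (ltW tq)); lra.
apply: (le_trans h2); rewrite ler_pM2l//.
have : (9 + 4 * n%:R) * w <= (9 + 4 * n%:R) by rewrite ler_piMr// ltW.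
lra.
Qed.

End maximum_principle.

(** * Spreading a property over the punctured space *)

Section propagation.
Context {R : realType} {n : nat} {P : 'rV[R]_n -> Prop}.
Implicit Types (x y z : 'rV[R]_n).
Hypothesis Pstep : forall y z, y != 0 -> P y -> dot (z - y) (z - y) < dot y y -> P z.

(** The ball of centre [s y] whose sphere passes through the origin contains [z] as soon as
    [|z|^2 < 2 s (z.y)]. Such centres are reached from [y] along its ray in steps of [y / 2]. *)
Let half_space {y z} : P y -> 0 < dot z y -> P z.
Proof.
move=> Py zy; have y0 : y != 0.
  by apply: contraTneq zy => ->; rewrite dot0r ltxx.
have yy : 0 < dot y y by rewrite dot_gt0.
have Pk k : P ((1 + k%:R / 2) *: y).
  elim: k => [|k IH]; first by rewrite mul0r addr0 scale1r.
  apply: Pstep IH _.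
    by rewrite scaler_eq0 negb_or y0 gt_eqF// ltr_pwDl// divr_ge0.
  rewrite -scalerBl !dotZl !dotZr.
  have -> : 1 + k.+1%:R / 2 - (1 + k%:R / 2) = 2^-1 :> R by rewrite -natr1; field.
  rewrite !mulrA ltr_pM2r//; have : (0 : R) <= k%:R by []; nra.
pose k := Num.trunc (dot z z / dot z y).
have kz : dot z z < k.+1%:R * dot z y by rewrite -ltr_pdivrMr// truncnS_gt.
apply: Pstep (Pk k) _.
  by rewrite scaler_eq0 negb_or y0 gt_eqF// ltr_pwDl// divr_ge0.
rewrite dot_sub_sqr !dotZl !dotZr; move: kz; rewrite -natr1; nra.
Qed.

(** Half-spaces lead from [y] to a point of a coordinate axis, then from axis to axis through the
    sum of two axis points, and finally to [z]. *)
Lemma propagates_everywhere {y z} : (1 < n)%N -> y != 0 -> P y -> z != 0 -> P z.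
Proof.
move=> n1; pose e (i : 'I_n) : 'rV[R]_n := delta_mx ord0 i.
have coord0 x : x != 0 -> exists i, x ord0 i != 0.
  move=> x0; apply/existsP; apply: contra_neqT x0; rewrite negb_exists.
  by move=> /forallP x0; apply/rowP => i; rewrite mxE; apply/eqP/negPn.
have dot_e a i x : dot x (a *: e i) = a * x ord0 i by rewrite dotC dotZl dot_delta.
have sq_gt0 (a : R) : a != 0 -> 0 < a * a by rewrite -expr2 lt0r sqrf_eq0 sqr_ge0 andbT.
have off_axis i j a b : a != 0 -> b != 0 -> j != i -> P (a *: e i) -> P (b *: e j).
  move=> a0 b0 ji Pi; have Pw : P (a *: e i + b *: e j).
    apply: half_space Pi _; rewrite dot_e !mxE !eqxx (eq_sym i) (negbTE ji)/=.
    by rewrite mulr1 mulr0 addr0 sq_gt0.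
  apply: half_space Pw _; rewrite dotC dot_e !mxE !eqxx (negbTE ji)/=.
  by rewrite mulr1 mulr0 add0r sq_gt0.
move=> /coord0[i yi] Py /coord0[k zk].
have Pi : P (y ord0 i *: e i) by apply: half_space Py _; rewrite dotC dot_e sq_gt0.
have [j ji] : exists j : 'I_n, j != i.
  have [i0|i0] := eqVneq (val i) 0%N; [exists (Ordinal n1)|exists (Ordinal (ltnW n1))].
    by rewrite -val_eqE/= i0.
  by rewrite -val_eqE/= eq_sym.
suff Pk : P (z ord0 k *: e k) by apply: half_space Pk _; rewrite dot_e sq_gt0.
(* On a single axis the two points may lie on opposite sides of the origin; a detour through a
   second axis joins them, which is where [1 < n] enters. *)
have [ki|ki] := eqVneq k i; last exact: off_axis Pi.
have Pj : P (1 *: e j) by apply: off_axis Pi => //; exact: oner_neq0.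
by apply: off_axis Pj; rewrite ?oner_neq0// ki eq_sym.
Qed.

End propagation.

(** * Bounding an integral below by a constant on a set *)

Section integral_lower_bound.
Context d {T : measurableType d} {R : realType}.
Import HBNNSimple.

(* No measurability of [f] is needed, since the integral of a nonnegative
   function is a supremum over the simple functions below it. *)
Lemma ge0_integral_ge_cst (mu : {measure set T -> \bar R}) (D A : set T)
    (f : T -> \bar R) (c : R) :
  measurable A -> A `<=` D -> 0 <= c -> (forall x, D x -> (0 <= f x)%E) ->
  (forall x, A x -> (c%:E <= f x)%E) -> (c%:E * mu A <= \int[mu]_(x in D) f x)%E.
Proof.
move=> mA AD c0 f0 cf; rewrite ge0_integralE//; apply: ereal_sup_ubound => /=.
exists (scale_nnsfun (indic_nnsfun R mA) c0).
  move=> x /=; rewrite measurable_realfun.mindicE patchE.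
  have [xA|xA] := boolP (x \in A).
    by rewrite mulr1 mem_set ?cf//; [rewrite inE in xA|apply: AD; rewrite inE in xA].
  by rewrite mulr0; case: ifPn => //; rewrite inE; exact: f0.
by rewrite sintegralrM sintegral_indic.
Qed.

End integral_lower_bound.

(** * Lower bounds for the Riesz potential *)

Section riesz.
Context {R : realType} {n : nat}.
Implicit Types (x y b : 'rV[R]_n).

(** Boxes serve as domains of integration in place of balls, because the product formula gives their
    measure at once. *)
Definition box b (h : R) : set 'rV[R]_n :=
  [set y | forall i, y ord0 i \in `]b ord0 i - h, b ord0 i + h[%R].

Lemma measurable_box b h : measurable (box b h).
Proof.
rewrite (_ : box b h = \bigcap_(i in [set: 'I_n])
    ((fun y : 'rV[R]_n => y ord0 i : measurableTypeR R) @^-1`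
      `]b ord0 i - h, b ord0 i + h[%classic)).
  apply: fin_bigcap_measurable => [|i _]; first exact: finite_finset.
  by rewrite -[X in measurable X]setTI; exact: measurable_coord.
by apply/seteqP; split=> y /= yb i; [move=> _|]; exact: yb.
Qed.

Lemma lebesgue_box {b h} : 0 <= h -> lebesgue_rV R n (box b h) = ((2 * h) ^+ n)%:E.
Proof.
move=> h0.
pose A i : set (measurableTypeR R) := `]b ord0 i - h, b ord0 i + h[%classic.
rewrite (@lebesgue_rV_box R n A) => [|i].
  rewrite (eq_bigr (fun=> (2 * h)%:E)) => [|i _].
    by rewrite prodEFin prodr_const card_ord.
  rewrite lebesgue_measure_itv/= lte_fin.
  have [_|hh] := ltP; first by rewrite -EFinD; congr EFin; ring.
  by congr EFin; lra.
exact: measurable_itv.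
Qed.

Lemma box_enorm {b h y} : (0 < n)%N -> 0 <= h -> box b h y -> enorm (y - b) <= n%:R * h.
Proof.
move=> n0 h0 yb; rewrite -ler_sqr ?nnegrE ?enorm_ge0 ?mulr_ge0// enorm_sqr.
have : dot (y - b) (y - b) <= \sum_(i < n) h ^+ 2.
  apply: ler_sum => i _; have := yb i; rewrite in_itv/= !mxE => /andP[]; nra.
rewrite sumr_const card_ord -[_ *+ n]mulr_natl => /le_trans; apply.
by rewrite exprMn ler_wpM2r ?sqr_ge0// expr2 ler_peMl// ler1n.
Qed.

Context {alpha p : R} {u : 'rV[R]_n -> R}.

Lemma riesz_ge0 x : (0 <= riesz_potential alpha p u x)%E.
Proof.
by apply: integral_ge0 => y _; rewrite lee_fin divr_ge0// powR_ge0.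
Qed.

(** The integrand is at least [c^p / r^(n - alpha)] on the box. Requiring [enorm (x - y)] to be
    positive excludes [y = x], where the integrand takes the default value 0. *)
Lemma riesz_ge_box {x b h c r} : 0 <= p -> alpha < n%:R -> 0 <= h -> 0 <= c ->
  (forall y, box b h y -> [/\ y != 0, c <= u y & 0 < enorm (x - y) <= r]) ->
  ((c `^ p / r `^ (n%:R - alpha) * (2 * h) ^+ n)%:E <= riesz_potential alpha p u x)%E.
Proof.
move=> p0 an h0 c0 ub; rewrite EFinM -(@lebesgue_box b h h0).
apply: ge0_integral_ge_cst.
- exact: measurable_box.
- by move=> y /ub[].
- by rewrite divr_ge0// powR_ge0.
- by move=> y _; rewrite lee_fin divr_ge0// powR_ge0.
move=> y /ub[y0 cu /andP[xy0 xyr]]; rewrite lee_fin.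
apply: ler_pM; rewrite ?invr_ge0 ?powR_ge0//.
  by apply: ge0_ler_powR; rewrite ?nnegrE// (le_trans c0).
have r0 := lt_le_trans xy0 xyr.
rewrite lef_pV2 ?posrE ?powR_gt0//.
by apply: ge0_ler_powR; rewrite ?nnegrE ?subr_ge0 ?(ltW an) ?(ltW xy0) ?(ltW r0).
Qed.

(** One constant serves both signs of [b]: the lower bound on [t] is used for [b >= 0], the upper
    bound for [b < 0]. *)
Lemma powR_comparable {L s t : R} (b : R) : 1 <= L -> 0 < s -> s / L <= t -> t <= L * s ->
  L `^ (- `|b|) * s `^ b <= t `^ b.
Proof.
move=> L1 s0 st ts; have L0 : 0 < L by lra.
have sL0 : 0 < s / L by rewrite divr_gt0.
have t0 : 0 < t := lt_le_trans sL0 st.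
have [b0|b0] := leP 0 b.
  rewrite ger0_norm// -mulN1r powRrM powR_inv1 ?(ltW L0)// mulrC.
  rewrite -powRM ?invr_ge0 ?(ltW s0) ?(ltW L0)//.
  by apply: ge0_ler_powR; rewrite ?nnegrE ?(ltW sL0) ?(ltW t0).
rewrite ltr0_norm// opprK -powRM ?(ltW s0) ?(ltW L0)// -(opprK b) 2!(powRN _ (- b)).
rewrite lef_pV2 ?posrE ?powR_gt0 ?mulr_gt0//.
apply: ge0_ler_powR; rewrite ?nnegrE ?oppr_ge0 ?mulr_ge0 ?(ltW b0)//.
- exact: ltW.
- exact: ltW.
- exact: ltW.
Qed.

End riesz.

(** * Iteration of the exponents *)

Lemma affine_iter_ge0 {R : realType} (n : nat) {a p s : R} :
  0 < a -> 0 < p -> 0 < s -> (n%:R - a) * p < n%:R * s ->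
  exists k, 0 <= iter k (fun b => (a + p * b) / s) ((a - n%:R) / s).
Proof.
move=> a0 p0 s0 h; pose F b := (a + p * b) / s; pose b0 := (a - n%:R) / s.
rewrite -/F -/b0.
apply: contrapT => /forallNP neg.
have {}neg k : iter k F b0 < 0 by rewrite ltNge; exact/negP/neg.
have sF b : s * F b = a + p * b by rewrite /F mulrC divfK// gt_eqF.
have sb0 : s * b0 = a - n%:R by rewrite /b0 mulrC divfK// gt_eqF.
have [d d0 step] : exists2 d, 0 < d & forall k, iter k F b0 + d <= iter k.+1 F b0.
  (* If [p < s], then [s (F b - b) = a - (s - p) b] exceeds [a] for negative [b]. *)
  have [ps|sp] := ltP p s.
    exists (a / s) => [|k]; first exact: divr_gt0.
    rewrite -(ler_pM2l s0) iterS sF mulrDr mulrCA divff ?gt_eqF// mulr1.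
    have := neg k; nra.
  (* Here [s^2 (F b0 - b0) = n s - (n - a) p], which is positive by [h]. *)
  have Fb0 : 0 < F b0 - b0.
    rewrite -(pmulr_rgt0 _ s0) mulrBr sF sb0.
    suff : 0 < s * (n%:R + p * b0) by rewrite pmulr_rgt0//; lra.
    have -> : s * (n%:R + p * b0) = s * n%:R + p * (s * b0) by ring.
    rewrite sb0; lra.
  (* Each increment is [p / s >= 1] times the previous one, so none is smaller than the first. *)
  exists (F b0 - b0) => //; elim=> [|k IH]; first by rewrite /= addrC subrK.
  apply: (@le_trans _ _ (iter k.+1 F b0 + (iter k.+1 F b0 - iter k F b0))); first lra.
  rewrite -(ler_pM2l s0) [iter k.+2 _ _]iterS sF mulrDr {1}[iter k.+1 _ _]iterS sF.
  have : 0 <= (p - s) * (iter k.+1 F b0 - iter k F b0) by rewrite mulr_ge0//; lra.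
  lra.
have lin k : b0 + k%:R * d <= iter k F b0.
  elim: k => [|k IH]; first by rewrite mul0r addr0.
  by apply: le_trans (step k); rewrite -natr1; lra.
pose k := Num.trunc (- b0 / d).
have : - b0 < k.+1%:R * d by rewrite -ltr_pdivrMr// truncnS_gt.
by have := lin k.+1; have := neg k.+1; lra.
Qed.

(** * Growth at infinity of the solution and of its potential *)

Section growth.
Context {R : realType} {n : nat} {alpha p q : R} {u : 'rV[R]_n -> R}.
Implicit Types (x y : 'rV[R]_n) (b : R).
Hypotheses (n1 : (1 < n)%N) (an : alpha < n%:R) (p0 : 0 < p) (q0 : 0 < q) (q1 : q < 1).

Definition growth b := exists c M : R, [/\ 0 < c, 0 < M &
  forall y, M <= enorm y -> c * enorm y `^ b <= u y].

Definition riesz_growth b := exists c M : R, [/\ 0 < c, 0 < M &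
  forall y, M <= enorm y -> ((c * enorm y `^ b)%:E <= riesz_potential alpha p u y)%E].

Let n0 : (0 : R) < n%:R.
Proof. by rewrite ltr0n ltnW. Qed.

(** On a box around [2 x] of size proportional to [|x|], both [|y|] and [|x - y|] are comparable to
    [|x|] and [|y| >= M]. The box thus contributes a multiple of
    [|x|^(p b) |x|^n / |x|^(n - alpha)]. *)
Lemma riesz_growth_of_growth {b} : growth b -> riesz_growth (alpha + p * b).
Proof.
move=> [c [M [c0 M0 uM]]].
exists ((c * 3 `^ (- `|b|)) `^ p / 2 `^ (n%:R - alpha) * (n%:R^-1) ^+ n), M.
have c3 : 0 < c * 3 `^ (- `|b|) by rewrite mulr_gt0// powR_gt0.
split => // [|x Mx].
  by rewrite mulr_gt0 ?exprn_gt0 ?invr_gt0// divr_gt0// powR_gt0.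
have x0 : 0 < enorm x := lt_le_trans M0 Mx.
(* Chosen so that [n h = |x| / 2], the distance bound that [box_enorm] gives. *)
pose h := enorm x / (2 * n%:R).
have h0 : 0 <= h by rewrite divr_ge0 ?enorm_ge0// mulr_ge0 ?ltW.
have nh : n%:R * h = enorm x / 2 by rewrite /h; field; rewrite gt_eqF.
apply: le_trans (@riesz_ge_box R n alpha p u x (2 *: x) h
  (c * 3 `^ (- `|b|) * enorm x `^ b) (2 * enorm x) (ltW p0) an h0 _ _).
- rewrite lee_fin le_eqVlt; apply/orP; left; apply/eqP.
  have -> : 2 * h = enorm x * n%:R^-1 by rewrite /h; field; rewrite gt_eqF.
  rewrite [(_ * enorm x `^ b) `^ p]powRM ?(ltW c3) ?powR_ge0//.
  rewrite [(2 * enorm x) `^ _]powRM ?(ltW x0)// exprMn -(powR_mulrn n (ltW x0)).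
  have -> : enorm x `^ (alpha + p * b) =
      (enorm x `^ b) `^ p * enorm x `^ n%:R / enorm x `^ (n%:R - alpha).
    rewrite -powRrM -powRN -!powRD ?(gt_eqF x0) ?implybT//.
    by congr (_ `^ _); ring.
  by field; rewrite !gt_eqF ?powR_gt0.
- by rewrite mulr_ge0 ?powR_ge0// ltW.
move=> y yb; have := box_enorm (ltnW n1) h0 yb; rewrite nh => yx.
have xE : enorm (2 *: x) = 2 * enorm x by rewrite enormZ.
have y1 : enorm (2 *: x) - enorm y <= enorm x / 2.
  by apply: le_trans yx; rewrite enormBC enormB_ge.
have y2 : enorm y - enorm (2 *: x) <= enorm x / 2.
  by apply: le_trans yx; exact: enormB_ge.
have xxE : enorm (2 *: x - x) = enorm x.
  by congr enorm; apply/rowP => i; rewrite !mxE; ring.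
split.
- by rewrite -enorm_gt0; lra.
- apply: le_trans (uM y _); last lra.
  rewrite -mulrA ler_pM2l//; apply: powR_comparable => //; lra.
- apply/andP; split.
    have := enormB_ge (2 *: x - x) (2 *: x - y).
    rewrite xxE (_ : 2 *: x - x - (2 *: x - y) = - (x - y)); last first.
      by apply/rowP => i; rewrite !mxE; ring.
    by rewrite enormN (enormBC (2 *: x)); lra.
  have := enormD (- (y - 2 *: x)) (- (2 *: x - x)).
  rewrite !enormN xxE (_ : - (y - 2 *: x) - (2 *: x - x) = x - y); last first.
    by apply/rowP => i; rewrite !mxE; ring.
  lra.
Qed.

Hypotheses (C2u : Ck 2 (@punctured R n) u) (upos : forall x, x != 0 -> 0 < u x).

(** A fixed box around a unit vector, on which [u] is bounded below, already contributes a multiple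
    of [|x|^(alpha - n)], since [|x - y| <= 2 |x|] there. *)
Lemma riesz_growth_start : riesz_growth (alpha - n%:R).
Proof.
pose e : 'rV[R]_n := delta_mx ord0 (Ordinal n1).
have e0 : e != 0 by rewrite -dot_gt0 dot_delta /e mxE !eqxx.
have e1 : enorm e = 1 by rewrite enormE dot_delta /e mxE !eqxx sqrtr1.
have ue := upos _ e0.
have [r r0 ur] : exists2 r : R, 0 < r & forall x, dot (x - e) (x - e) < r -> u e / 2 < u x.
  apply: near_dot_lt; apply: cvgr_gt (C2u.1 e e0) _ _; lra.
(* The bound [1 / 2] keeps the box off the origin; both bounds together give [rho^2 <= r / 4 < r],
   where [r] is a squared radius. *)
pose rho := Num.min (1 / 2) (r / 2).
have [rho1 rhor] : rho <= 1 / 2 /\ rho <= r / 2 by rewrite !ge_min !lexx orbT.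
have rho0 : 0 < rho by rewrite lt_min; apply/andP; split; lra.
pose h := rho / n%:R.
have h0 : 0 < h by rewrite divr_gt0.
have nh : n%:R * h = rho by rewrite mulrC divfK// gt_eqF.
exists ((u e / 2) `^ p / 2 `^ (n%:R - alpha) * (2 * h) ^+ n), 3.
split=> // [|x x3].
  by rewrite !mulr_gt0 ?invr_gt0 ?exprn_gt0 ?powR_gt0 ?mulr_gt0 ?invr_gt0.
have x0 : 0 < enorm x by lra.
apply: le_trans (@riesz_ge_box R n alpha p u x e h (u e / 2) (2 * enorm x)
  (ltW p0) an (ltW h0) _ _).
- rewrite lee_fin le_eqVlt; apply/orP; left; apply/eqP.
  rewrite [(2 * enorm x) `^ _]powRM ?(ltW x0)// -(opprB n%:R) powRN.
  by field; rewrite !gt_eqF ?powR_gt0.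
- lra.
move=> y yb; have := box_enorm (ltnW n1) (ltW h0) yb; rewrite nh => ye.
have y1 : enorm e - enorm y <= rho.
  by apply: le_trans ye; rewrite enormBC enormB_ge.
have y2 : enorm y - enorm e <= rho by apply: le_trans ye; exact: enormB_ge.
split.
- by rewrite -enorm_gt0; lra.
- apply/ltW/ur; rewrite -enorm_sqr.
  have := enorm_ge0 (y - e); nra.
- have := enormB_ge x y; have := enormD x (- y); rewrite enormN.
  by move=> ? ?; apply/andP; split; lra.
Qed.

Hypothesis ueq : forall x, x != 0 ->
  - laplacian u x + u x = fine (riesz_potential alpha p u x) * u x `^ q.
Hypothesis ufin : forall x, x != 0 -> riesz_potential alpha p u x \is a fin_num.

Lemma growth_of_riesz_growth {b} : riesz_growth b -> growth (b / (1 - q)).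
Proof.
move=> [c [M [c0 M0 uM]]].
pose K := ball_const (R:=R) (n:=n) * (c * 2 `^ (- `|b|)).
have K0 : 0 < K by rewrite !mulr_gt0 ?ball_const_gt0 ?powR_gt0.
(* If [|y| >= M + 2], every [x] in the unit ball around [y] has [|x| >= M] and lies within a factor
   2 of [|y|] in norm, hence the constant [2^(- |b|)]. *)
exists (K `^ (1 - q)^-1), (M + 2); split; [exact: powR_gt0|lra|move=> y My].
have y0 : 0 < enorm y by lra.
have s0 : 0 < 1 - q by rewrite subr_gt0.
have : K * enorm y `^ b <= u y `^ (1 - q).
  rewrite /K -mulrA; apply: powR_lower_bound => //.
  - by rewrite !mulr_gt0 ?powR_gt0.
  - by rewrite -enorm_sqr expr_gt1 ?enorm_ge0//; lra.
  move=> x; rewrite -enorm_sqr expr_le1 ?enorm_ge0// => xy.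
  have x1 : enorm y - enorm x <= 1.
    by apply: le_trans xy; rewrite enormBC enormB_ge.
  have x2 : enorm x - enorm y <= 1 by apply: le_trans xy; exact: enormB_ge.
  have x0 : x != 0 by rewrite -enorm_gt0; lra.
  rewrite ueq// ler_pM2r ?powR_gt0 ?upos// -lee_fin fineK ?ufin//.
  apply: le_trans (uM x _); last lra.
  rewrite lee_fin -mulrA ler_pM2l//; apply: powR_comparable => //; lra.
have uy : 0 < u y by rewrite upos// -enorm_gt0.
move=> h; rewrite powRrM -powRM ?powR_ge0 ?(ltW K0)//.
have -> : u y = (u y `^ (1 - q)) `^ (1 - q)^-1.
  by rewrite -powRrM divff ?gt_eqF// powRr1 ?(ltW uy).
apply: ge0_ler_powR; rewrite ?nnegrE ?invr_ge0 ?powR_ge0 ?(ltW s0)//.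
by rewrite mulr_ge0 ?powR_ge0// ltW.
Qed.

End growth.

(** * Nonexistence: the iterated bounds against decay at infinity *)

Theorem theorem1p1 (R : realType) (N : nat) (alpha p q : R)
  (hN : (3 <= N)%N)
  (halpha : 0 < alpha < N%:R)
  (hp : 0 < p)
  (hq : 0 < q < 1)
  (hpq1 : (1 - alpha / N%:R) * p + q < 1)
  (hpq2 : p + q < 1 + alpha / (N%:R - 2)) :
  ~ exists u : 'rV[R]_N -> R,
      nonneg_classical_solution alpha p q u /\ nontrivial u.
Proof.
move=> [u [[u0 C2u ufin ueq ulim] [y y0 uy]]].
have [a0 aN] := andP halpha; have [q0 q1] := andP hq.
have N1 : (1 < N)%N := ltnW hN.
have N0 : (0 : R) < N%:R by rewrite ltr0n ltnW.
have s0 : 0 < 1 - q by rewrite subr_gt0.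
have lapu x : x != 0 -> laplacian u x <= u x.
  move=> x0; rewrite -subr_ge0 addrC ueq// mulr_ge0 ?powR_ge0//.
  exact/fine_ge0/riesz_ge0.
have upos x : x != 0 -> 0 < u x.
  apply: (propagates_everywhere (P := fun x => 0 < u x) _ N1 y0).
    by move=> v w; exact: pos_propagates.
  by rewrite lt0r uy u0.
(* This is [hpq1] multiplied by [N], in the form that the iteration of exponents takes. *)
have Np : (N%:R - alpha) * p < N%:R * (1 - q).
  have : N%:R * ((1 - alpha / N%:R) * p + q) < N%:R * 1 by rewrite ltr_pM2l.
  have : N%:R * ((1 - alpha / N%:R) * p + q) = (N%:R - alpha) * p + N%:R * q.
    by field; rewrite gt_eqF.
  lra.
have rg b : riesz_growth (alpha := alpha) (p := p) (u := u) b ->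
    growth (u := u) (b / (1 - q)).
  exact: (growth_of_riesz_growth q0 q1 C2u upos ueq ufin).
have gr k : growth (u := u) (iter k (fun b => (alpha + p * b) / (1 - q))
    ((alpha - N%:R) / (1 - q))).
  elim: k => [|k IH]; first exact: (rg _ (riesz_growth_start N1 aN hp C2u upos)).
  by rewrite iterS; exact: (rg _ (riesz_growth_of_growth N1 aN hp IH)).
have [k] := affine_iter_ge0 N a0 hp s0 Np.
have {gr} := gr k; set b := iter k _ _ => -[c [M [c0 M0 uM]]] b0.
have [L _ uL] := ulim _ (nbhsx_ballx (0 : R) c c0).
(* [M] makes the growth bound available, [1] gives [s^b >= 1] for [b >= 0], and [L + 1] puts [x]
   strictly beyond the radius past which [|u| < c]. *)
pose s := Num.max M (Num.max 1 (L + 1)).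
have [sM s1 sL] : [/\ M <= s, 1 <= s & L + 1 <= s].
  by split; rewrite !le_max lexx ?orbT.
pose x : 'rV[R]_N := s *: delta_mx ord0 (Ordinal N1).
have xs : enorm x = s.
  by rewrite enormZ ?(le_trans ler01 s1)// enormE dot_delta mxE !eqxx sqrtr1 mulr1.
have := uM x; rewrite xs => /(_ sM) cu.
have : ball 0 c (u x) by apply: uL => /=; rewrite xs; lra.
rewrite /ball/= sub0r normrN; apply/negP; rewrite -leNgt.
apply: le_trans (ler_norm _); apply: le_trans cu; rewrite ler_peMr ?(ltW c0)//.
by rewrite -(powRr0 s) ler_powR.
Qed.
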